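(* Let $n$ and $m$ be two natural numbers (positive integers). Then there exist $l\in\mathbb{N}$ and a divisor $f(x)=\sum_{i=0}^{\deg(f)}a_ix^i\in\mathbb{Z}[x]$ of $x^{l}-1$ having exactly $m$ irreducible factors in $\mathbb{Z}[x]$ such that $\{-n,-n+1,\ldots,0,\ldots,n-1,n\}\subset\{a_1,\ldots,a_{\deg(f)}\}$.
   Context: Divisors of $x^l-1$ are taken in $\mathbb{Z}[x]$. Since $x^l-1=\prod_{d\mid l}\phi_d(x)$, where $\phi_d$ is the $d$-th cyclotomic polynomial, $x^l-1$ is squarefree and its irreducible factors are the distinct polynomials $\phi_d$, $d\mid l$ (up to sign). ''Exactly $m$ irreducible factors'' means that $f$ is, up to sign, a product of exactly $m$ of these. Note that the constant coefficient $a_0$ is not included in the set $\{a_1,\ldots,a_{\deg(f)}\}$. *)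

(* Defs.v *)
From mathcomp Require Import all_boot all_order all_algebra.

Set Implicit Arguments.
Unset Strict Implicit.
Unset Printing Implicit Defensive.

Import Order.TTheory GRing.Theory Num.Theory.
Local Open Scope ring_scope.

(* Over int, MathComp's p %| q and irreducible_poly are defined by
   pseudo-division, so they amount to divisibility and irreducibility in Q[x]:
   2%:P divides 'X, and 2%:P * 'X is irreducible.  The notions below are the
   ring-theoretic ones, which for R = {poly int} are those of Z[x]. *)

Definition ring_dvd (R : comUnitRingType) (a b : R) : Prop :=
  exists c : R, b = c * a.

Definition ring_associate (R : comUnitRingType) (a b : R) : Prop :=
  exists2 u : R, u \is a GRing.unit & b = u * a.

Definition ring_irreducible (R : comUnitRingType) (a : R) : Prop :=
  [/\ a != 0, a \isn't a GRing.unit &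
      forall b c : R, a = b * c -> b \is a GRing.unit \/ c \is a GRing.unit].

(* The factors p i are pairwise non-associate, so a is squarefree and m counts
   its irreducible factors both with and without multiplicity.  The units of
   {poly int} are 1 and -1, so there u is a sign. *)
Definition has_exactly_irreducible_factors (R : comUnitRingType)
    (m : nat) (a : R) : Prop :=
  exists (u : R) (p : 'I_m -> R),
    [/\ u \is a GRing.unit,
        forall i, ring_irreducible (p i),
        forall i j, i != j -> ~ ring_associate (p i) (p j) &
        a = u * \prod_(i < m) p i].

(* Main.v *)
Require Import Defs.
From mathcomp Require Import all_boot all_order all_algebra all_field zify ring.
Import Order.TTheory GRing.Theory Num.Theory.
Local Open Scope ring_scope.

(** Suzuki's argument.  Let y be such that ]y, 2y] contains an odd number t of
    primes p_1 < ... < p_t with t large; some y works because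
    2^N <= 'C(2N, N) <= (2N)^pi(2N) forces many primes into some ]2^k, 2^(k+1)].
    Put N = 2 p_1 ... p_t.  From Phi_(Mp)(x) Phi_M(x) = Phi_M(x^p) and the fact
    that x^(p_i + p_j) vanishes modulo x^(2y+2),
      (1 + x) Phi_N(x) = 1 + x^p_1 + ... + x^p_t  modulo x^(2y+2),
    so the k-th coefficient of Phi_N is (-1)^k (1 - #{i | p_i <= k}).  It is
    j - 1 at k = p_j and 1 - j at k = p_j + 1, which settles m = 1.  For larger
    m, multiply Phi_N by Phi_(q^(i+1)), 1 <= i < m, for a large prime q: these
    factors are 1 modulo x^q, so the low coefficients do not change. *)

(** * Chebyshev-type estimates and primes in dyadic intervals *)

Section PrimesInDyadicIntervals.

Local Open Scope nat_scope.

(** In Pascal's rule for C(2N + 2, N + 1), both summands are at least C(2N, N). *)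
Lemma expn2_le_central_bin N : 2 ^ N <= 'C(N.*2, N).
Proof.
elim: N => // N IHN; rewrite doubleS binS expnS mul2n -addnn leq_add //.
  by rewrite (leq_trans IHN) // binS leq_addl.
by rewrite (leq_trans IHN) // leq_bin2l.
Qed.

(** By Legendre's formula the exponent of p is the sum over k of floor(2N/p^k) - 2 floor(N/p^k).
    Each term is 0 or 1, and it is 0 once p^k > 2N. *)
Lemma pfactor_central_bin [p N] : prime p -> 0 < N ->
  p ^ logn p 'C(N.*2, N) <= N.*2.
Proof.
move=> p_pr N_gt0; have p_gt1 := prime_gt1 p_pr.
suff le_log : logn p 'C(N.*2, N) <= trunc_log p N.*2.
  rewrite (leq_trans (leq_pexp2l (ltnW p_gt1) le_log)) //.
  by rewrite trunc_logP ?double_gt0.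
have le_N2 : N <= N.*2 by lia.
have /(congr1 (logn p)) := bin_fact le_N2.
rewrite !lognM ?muln_gt0 ?fact_gt0 ?bin_gt0 // (_ : N.*2 - N = N); last by lia.
(* Brings the Legendre sums for N! and (2N)! to one range of k; the added terms have p^k > n and
   vanish. *)
have widen_fact n : n <= N.*2 ->
    \sum_(1 <= k < n.+1) n %/ p ^ k = \sum_(1 <= k < N.*2.+1) n %/ p ^ k.
  move=> le_n; rewrite [RHS](big_cat_nat (n := n.+1)) //=.
  rewrite [X in _ + X]big1_seq ?addn0 // => k.
  rewrite mem_index_iota => /and3P[_ lt_n _].
  by rewrite divn_small // (ltn_trans _ (ltn_expl k p_gt1)).
rewrite !logn_fact // (widen_fact N) // -big_split /=.
have : \sum_(1 <= k < N.*2.+1) N.*2 %/ p ^ k <=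
       \sum_(1 <= k < N.*2.+1)
          (N %/ p ^ k + N %/ p ^ k + (k <= trunc_log p N.*2)).
  apply: leq_sum => k _.
  case: (leqP k) => [_|/(leq_pexp2l (ltnW p_gt1)) lt_k]; last first.
    by rewrite divn_small // (leq_trans _ lt_k) // trunc_log_ltn.
  have q_gt0 : 0 < p ^ k by rewrite expn_gt0 ltnW.
  rewrite addn1 -ltnS ltn_divLR //.
  have := ltn_ceil N q_gt0; nia.
rewrite big_split /=.
suff : \sum_(1 <= k < N.*2.+1) (k <= trunc_log p N.*2) <= trunc_log p N.*2.
  by lia.
rewrite -big_mkcond /= sum1_count.
apply: leq_trans (_ : size (index_iota 1 (trunc_log p N.*2).+1) <= _); last first.
  by rewrite size_iota; lia.
rewrite -size_filter uniq_leq_size ?filter_uniq ?iota_uniq // => k.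
by rewrite mem_filter !mem_index_iota; lia.
Qed.

Lemma central_bin_le N : 0 < N ->
  'C(N.*2, N) <= N.*2 ^ count prime (index_iota 0 N.*2.+1).
Proof.
move=> N_gt0; have le_N2 : N <= N.*2 by lia.
have C_gt0 : 0 < 'C(N.*2, N) by rewrite bin_gt0.
rewrite {1}(prod_prime_decomp C_gt0) prime_decompE big_map /= big_seq.
apply: leq_trans (_ : \prod_(p <- primes 'C(N.*2, N)
                            | p \in primes 'C(N.*2, N)) N.*2 <= _).
  apply: leq_prod => p; rewrite mem_primes => /andP[p_pr _].
  exact: pfactor_central_bin.
rewrite -big_seq big_const_seq count_predT iter_muln_1.
rewrite leq_pexp2l ?double_gt0 //.
rewrite -size_filter uniq_leq_size ?primes_uniq // => p p_C.
have:= p_C; rewrite mem_primes => /and3P[p_pr _ _].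
rewrite mem_filter p_pr mem_iota prime_gt0 //=.
rewrite ltnS (leq_trans _ (pfactor_central_bin p_pr N_gt0)) //.
by rewrite -{1}[p]expn1 leq_pexp2l ?logn_gt0 ?(prime_gt0 p_pr).
Qed.

Lemma many_primes_in_dyadic_interval t :
  exists2 y, 1 < y & t <= count prime (index_iota y.+1 y.*2.+1).
Proof.
(* The factor 25 turns the bound (5j)(5j(t + 1)) reached below into j^3, which contradicts j^4 <
   2^(4j). *)
set j := 25 * t.+1.
have [/hasP[k _ le_t]|/hasPn no_k] := boolP
    (has (fun k => t <= count prime (index_iota (2 ^ k.+1).+1 (2 ^ k.+1).*2.+1))
         (iota 0 (4 * j))).
  by exists (2 ^ k.+1); rewrite // -{1}(expn0 2) ltn_exp2l.
(* If each of these intervals has fewer than t primes, the number of primes up to 2^(k+1) grows only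
   linearly in k; the summand 1 counts the prime 2. *)
have pi_le k : k <= 4 * j ->
    count prime (index_iota 0 (2 ^ k.+1).+1) <= t * k + 1.
  elim: k => [|k IHk] lt_k; first by rewrite muln0.
  have /no_k : k \in iota 0 (4 * j) by rewrite mem_iota.
  have D2k : (2 ^ k.+2).+1 =
      (2 ^ k.+1).+1 + ((2 ^ k.+1).*2.+1 - (2 ^ k.+1).+1).
    by rewrite (expnS _ k.+1); lia.
  have -> : index_iota 0 (2 ^ k.+2).+1 =
      index_iota 0 (2 ^ k.+1).+1 ++ index_iota (2 ^ k.+1).+1 (2 ^ k.+1).*2.+1.
    by rewrite /index_iota !subn0 D2k iotaD.
  by rewrite count_cat -ltnNge mulnS => ?; have := IHk (ltnW lt_k); lia.
have /central_bin_le : 0 < 2 ^ (4 * j) by rewrite expn_gt0.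
move/(leq_trans (expn2_le_central_bin _)).
rewrite -mul2n -expnS -expnM leq_exp2l // => le_2j.
have {}le_2j : 2 ^ (4 * j) <= (4 * j).+1 * (t * (4 * j) + 1).
  by rewrite (leq_trans le_2j) // leq_mul2l pi_le // leqnn orbT.
have lt_j := ltn_expl j (ltnSn 1).
have : j ^ 4 < 2 ^ (4 * j) by rewrite mulnC expnM ltn_exp2r.
have [j_gt0 Dj] : 0 < j /\ j = 25 * t.+1 by [].
have le1 : (4 * j).+1 <= 5 * j by lia.
have le2 : t * (4 * j) + 1 <= 5 * j * t.+1 by clear -j_gt0; nia.
have le3 : (4 * j).+1 * (t * (4 * j) + 1) <= j ^ 3.
  rewrite (leq_trans (leq_mul le1 le2)) // [in j ^ 3]expnS {2}Dj !expnS expn0.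
  by clear; lia.
by rewrite ltnNge (leq_trans le_2j) // (leq_trans le3) // leq_pexp2l.
Qed.

End PrimesInDyadicIntervals.

(** * Cyclotomic polynomials as irreducible factors of x^l - 1 *)

(** A factor vanishing at a primitive n-th root of unity z is a multiple of the minimal polynomial
    of z over Q, whose degree is that of Phi_n. The cofactor is then a constant, and a unit because
    Phi_n is monic. *)
Lemma ring_irreducible_Cyclotomic n : (0 < n)%N -> ring_irreducible 'Phi_n.
Proof.
move=> n_gt0; have [z prim_z] := C_prim_root_exists n_gt0.
have Phi_monic := Cyclotomic_monic n.
have root_unit b c : 'Phi_n = b * c ->
    root (map_poly (intr : int -> algC) b) z -> c \is a GRing.unit.
  move=> Dbc b_z.
  have [b0 c0] : b != 0 /\ c != 0.
    by apply/andP; rewrite -negb_or -mulf_eq0 -Dbc monic_neq0.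
  have le_b : (size 'Phi_n <= size b)%N.
    have [p [Dp p_monic] dv_p] := minCpolyP z.
    have := dv_p (map_poly intr b); rewrite -map_poly_comp /=.
    rewrite (eq_map_poly (g := intr)); last by move=> a /=; rewrite ratr_int.
    rewrite b_z => /esym/dvdp_leq; rewrite map_poly_eq0_id0; last first.
      by rewrite intr_eq0 lead_coef_eq0.
    rewrite size_map_inj_poly //; last exact: intr_inj.
    rewrite (_ : size p = size 'Phi_n) //; first exact.
    rewrite -(size_map_poly (ratr : rat -> algC)) -Dp.
    by rewrite (minCpoly_cyclotomic prim_z) size_cyclotomic size_Cyclotomic.
  have size_c : size c = 1%N.
    have eq1 x y k : (x <= y)%N -> (0 < k)%N -> x = (y + k).-1 -> k = 1%N.
      by lia.
    apply: eq1 le_b _ _; first by rewrite size_poly_gt0.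
    by rewrite Dbc size_mul.
  rewrite poly_unitE size_c eqxx /=.
  have /monicP := Phi_monic.
  rewrite Dbc lead_coefM (lead_coefE c) size_c /= => lead1.
  by apply/unitrP; exists (lead_coef b); rewrite lead1 mulrC lead1.
split; first exact: monic_neq0.
  by rewrite poly_unitE size_Cyclotomic eqSS eqn0Ngt totient_gt0 n_gt0.
move=> b c Dbc.
have : root (map_poly (intr : int -> algC) 'Phi_n) z.
  by rewrite (Cintr_Cyclotomic prim_z) root_cyclotomic.
rewrite Dbc rmorphM rootM => /orP[b_z|c_z]; first by right; apply: root_unit b_z.
by left; apply: root_unit c_z; rewrite mulrC.
Qed.

(** The multiplicative order of any complex root recovers the index. *)
Lemma Cyclotomic_inj : {in [pred n | 0 < n]%N &, injective Cyclotomic}.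
Proof.
move=> d e /= d_gt0 e_gt0 eq_Phi.
have [z prim_z] := C_prim_root_exists d_gt0.
have [w prim_w] := C_prim_root_exists e_gt0.
have := root_cyclotomic prim_w z.
rewrite -(Cintr_Cyclotomic prim_w) -eq_Phi (Cintr_Cyclotomic prim_z).
rewrite root_cyclotomic // prim_z => /esym prim_ze.
apply/eqP; rewrite eqn_dvd (prim_order_dvd prim_z) (prim_order_dvd prim_ze).
by rewrite !prim_expr_order ?eqxx.
Qed.

Lemma ring_associate_monic (p q : {poly int}) :
  p \is monic -> q \is monic -> ring_associate p q -> p = q.
Proof.
move=> p_monic q_monic [u].
rewrite poly_unitE => /andP[/size_poly1P[c _ ->] _] Dq.
move: (monicP q_monic).
rewrite Dq lead_coefM (monicP p_monic) lead_coefC mulr1 => ->.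
by rewrite mul1r.
Qed.

Lemma ring_dvd_prod_seq [R : comUnitRingType] [I : finType] [J : eqType]
    [r : seq J] [d : I -> J] (F : J -> R) :
  uniq r -> injective d -> (forall i, d i \in r) ->
  ring_dvd (\prod_i F (d i)) (\prod_(j <- r) F j).
Proof.
move=> r_uniq d_inj d_r; exists (\prod_(j <- r | j \notin codom d) F j).
rewrite mulrC (bigID (mem (codom d))) /=; congr (_ * _).
rewrite -big_filter -[RHS](big_map d predT F); apply/perm_big/uniq_perm.
- by rewrite filter_uniq.
- by rewrite map_inj_uniq // index_enum_uniq.
move=> j; rewrite mem_filter; apply/andP/mapP => [[/codomP[i ->] _]|[i _ ->]].
  by exists i; rewrite ?mem_index_enum.
by rewrite codom_f.
Qed.

Lemma has_exactly_irreducible_factors_Cyclotomic m (d : 'I_m -> nat) :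
  injective d -> (forall i, 0 < d i)%N ->
  has_exactly_irreducible_factors m (\prod_i 'Phi_(d i)).
Proof.
move=> d_inj d_gt0; exists 1, (fun i => 'Phi_(d i)); split; first exact: unitr1.
- by move=> i; apply: ring_irreducible_Cyclotomic.
- move=> i j ne_ij.
  move/(ring_associate_monic _ _ (Cyclotomic_monic _) (Cyclotomic_monic _)).
  by move/Cyclotomic_inj => /(_ (d_gt0 i) (d_gt0 j))/d_inj/eqP; apply/negP.
- by rewrite mul1r.
Qed.

(** * Cyclotomic identities at primes and prime powers *)

(** Taken over all d dividing n, the products of both sides equal x^(np) - 1, since the divisors of
    np are the d and the dp. By strong induction the factors at d < n agree, and being monic they
    cancel. *)
Lemma Cyclotomic_mul_prime [p n] : prime p -> ~~ (p %| n)%N ->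
  'Phi_(n * p) * 'Phi_n = 'Phi_n \Po 'X^p.
Proof.
move=> p_pr; have p_gt0 := prime_gt0 p_pr.
elim/ltn_ind: n => n IHn p'n.
have n_gt0 : (0 < n)%N by case: n p'n {IHn} => //; rewrite dvdn0.
have co_d d : (d %| n)%N -> coprime d p.
  move=> dv_d; rewrite coprime_sym prime_coprime // (contra _ p'n) //.
  by move/dvdn_trans->.
have perm_div : perm_eq (divisors (n * p))
                        (map (muln^~ p) (divisors n) ++ divisors n).
  apply: uniq_perm; rewrite ?cat_uniq ?map_inj_uniq ?divisors_uniq ?andbT //=.
  - apply/hasPn => d; rewrite -dvdn_divisors // => /co_d co_dp.
    apply/mapP => -[e _ Dd]; move: co_dp; rewrite Dd coprimeMl => /andP[_].
    by rewrite /coprime gcdnn => /eqP p1; rewrite p1 in p_pr.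
  - by move=> a b /eqP; rewrite eqn_pmul2r // => /eqP.
  move=> d; rewrite mem_cat -!dvdn_divisors ?muln_gt0 ?n_gt0 //.
  apply/idP/orP => [dv_d|[/mapP[e]|dv_d]]; last by rewrite dvdn_mulr.
    have [p_d|p'd] := boolP (p %| d)%N; last first.
      right; rewrite -(Gauss_dvdl _ (_ : coprime d p)) //.
      by rewrite coprime_sym prime_coprime.
    left; apply/mapP; exists (d %/ p)%N; last by rewrite divnK.
    by rewrite -dvdn_divisors // -(dvdn_pmul2r p_gt0) divnK.
  by rewrite -dvdn_divisors // => dv_e ->; rewrite dvdn_pmul2r.
have eq_prod : \prod_(d <- divisors n) ('Phi_(d * p) * 'Phi_d) =
               \prod_(d <- divisors n) ('Phi_d \Po 'X^p).
  rewrite big_split /= -(big_map (muln^~ p) predT Cyclotomic) -big_cat /=.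
  rewrite -(perm_big _ perm_div) prod_Cyclotomic ?muln_gt0 ?n_gt0 //.
  rewrite -rmorph_prod /= prod_Cyclotomic // rmorphB /= rmorphXn /= comp_polyX.
  by rewrite rmorph1 -exprM mulnC.
move: eq_prod; rewrite !(bigD1_seq n) ?divisors_id ?divisors_uniq //=.
rewrite [X in _ = _ * X](_ : _ =
    \prod_(d <- divisors n | d != n) ('Phi_(d * p) * 'Phi_d)).
  apply: mulIf; apply: monic_neq0; apply: monic_prod => d _.
  by rewrite monicMl ?Cyclotomic_monic.
rewrite big_seq_cond [RHS]big_seq_cond; apply: eq_bigr => d /andP[].
rewrite -dvdn_divisors // => dv_d ne_d; apply/esym/IHn.
  by rewrite ltn_neqAle ne_d dvdn_leq.
by rewrite -prime_coprime // coprime_sym co_d.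
Qed.

Lemma Cyclotomic_prime_power_mul q k : prime q ->
  'Phi_(q ^ k.+1)%N * ('X^(q ^ k)%N - 1) = 'X^(q ^ k.+1)%N - 1.
Proof.
move=> q_pr; have q_gt0 j : (0 < q ^ j)%N by rewrite expn_gt0 prime_gt0.
rewrite -(prod_Cyclotomic (q_gt0 k)) -(prod_Cyclotomic (q_gt0 k.+1)).
suff /(perm_big _)-> :
    perm_eq (divisors (q ^ k.+1)) ((q ^ k.+1)%N :: divisors (q ^ k)).
  by rewrite big_cons.
apply: uniq_perm; rewrite /= ?divisors_uniq ?andbT //.
  by rewrite -dvdn_divisors // dvdn_Pexp2l ?prime_gt1 // ltnn.
move=> d; rewrite inE -!dvdn_divisors //.
apply/(dvdn_pfactor _ _ q_pr)/orP
  => [[j]|[/eqP->|/(dvdn_pfactor _ _ q_pr)[j le_j ->]]].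
- rewrite leq_eqVlt => /orP[/eqP-> ->|lt_j ->]; first by left.
  by right; apply/(dvdn_pfactor _ _ q_pr); exists j.
- by exists k.+1.
by exists j; first exact: leqW.
Qed.

(** * Low coefficients of Phi_(2 p_1 ... p_t) *)

(** Congruences modulo x^K carry an explicit cofactor h, so that they can be combined by [ring]. *)
Lemma coef_eq_modXn (p q : {poly int}) K :
  (forall i, (i < K)%N -> p`_i = q`_i) -> exists h, p = q + h * 'X^K.
Proof.
move=> eq_pq; exists (drop_poly K p - drop_poly K q).
rewrite -{1}(poly_take_drop K p) -{1}(poly_take_drop K q).
have -> : take_poly K p = take_poly K q.
  by apply/polyP => i; rewrite !coef_take_poly; case: ifP => // /eq_pq.
ring.
Qed.

Lemma comp_polyXn_modXn (q : {poly int}) [p K] : (0 < p)%N -> (K <= p * 2)%N ->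
  exists h, q \Po 'X^p = (q`_0)%:P + (q`_1)%:P * 'X^p + h * 'X^K.
Proof.
move=> p_gt0 le_K; apply: coef_eq_modXn => i lt_i.
rewrite coef_comp_poly_Xn // coefD coefC coefCM coefXn.
case: dvdnP => [[j Di]|p'i].
  have : (j < 2)%N by rewrite -(ltn_pmul2r p_gt0) -Di (leq_trans lt_i) // mulnC.
  rewrite {}Di mulnK //; case: j => [|[|]] // _.
    by rewrite mul0n /= [0 == p]eq_sym gtn_eqF // mulr0 addr0.
  by rewrite mul1n eqxx gtn_eqF // mulr1 add0r.
have [i0|_] := eqVneq i 0%N; first by case: p'i; exists 0%N.
have [ip|_] := eqVneq i p; first by case: p'i; exists 1%N; rewrite mul1n.
by rewrite mulr0 addr0.
Qed.

Lemma coef_add_mulXn (p h : {poly int}) [K i] :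
  (i < K)%N -> (p + h * 'X^K)`_i = p`_i.
Proof. by move=> lt_i; rewrite coefD coefMXn lt_i addr0. Qed.

Lemma coef_sumXn (s : seq nat) i :
  (\sum_(p <- s) 'X^p : {poly int})`_i = (count_mem i s)%:R.
Proof.
rewrite coef_sum; elim: s => [|p s IHs]; first by rewrite big_nil.
by rewrite big_cons IHs coefXn /= natrD eq_sym.
Qed.

(* These identities multiply by 1 + T * G, resp. 1 - T * G, to invert
   1 - T * G, resp. 1 + T * G, modulo T ^+ 2.  They are applied to F = Phi_N,
   F' = Phi_(N * p), T = x^(y+1), T * G = sum of the x^p_i and T * g = x^p. *)
Lemma Suzuki_step_even [R : comPzRingType] [F F' X T G g h1 h2 : R] :
  F = (1 + X) * (1 - T * G) + h1 * T ^+ 2 ->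
  F' * F = 1 + T * g + h2 * T ^+ 2 ->
  exists h, F' * (1 + X) = 1 + T * (g + G) + h * T ^+ 2.
Proof.
move=> DF DF'.
exists (F' * (1 + X) * G ^+ 2 + (1 + T * G) * (h2 - F' * h1) + g * G).
transitivity ((1 + T * G) * (F' * F) - F' * h1 * T ^+ 2 * (1 + T * G)
              + F' * (1 + X) * G ^+ 2 * T ^+ 2).
  by rewrite DF; ring.
by rewrite DF'; ring.
Qed.

Lemma Suzuki_step_odd [R : comPzRingType] [F F' X T G g h1 h2 : R] :
  F * (1 + X) = 1 + T * G + h1 * T ^+ 2 ->
  F' * F = 1 - T * g + h2 * T ^+ 2 ->
  exists h, F' = (1 + X) * (1 - T * (g + G)) + h * T ^+ 2.
Proof.
move=> DF DF'.
exists (F' * G ^+ 2 + (1 - T * G) * (h2 * (1 + X) - F' * h1) + (1 + X) * g * G).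
transitivity ((1 - T * G) * (F' * (F * (1 + X)))
              - F' * h1 * T ^+ 2 * (1 - T * G) + F' * G ^+ 2 * T ^+ 2).
  by rewrite DF; ring.
by rewrite mulrA DF'; ring.
Qed.

Lemma Cyclotomic_2 : 'Phi_2 = 1 + 'X.
Proof.
have := @prod_Cyclotomic 2 isT; rewrite !big_cons big_nil mulr1 /=.
have := @prod_Cyclotomic 1 isT; rewrite !big_cons big_nil mulr1 /= => ->.
have -> : 'X^2 - 1 = ('X^1 - 1) * (1 + 'X) :> {poly int} by ring.
by apply: mulfI; rewrite monic_neq0 ?monicXnsubC.
Qed.

(** Induction on s from Phi_2 = 1 + x. Each new prime p gives Phi_(Np) as Phi_N(x^p) divided by
    Phi_N, which exchanges the two forms. *)
Lemma Cyclotomic_double_prod_modXn [y s] :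
  uniq s -> {in s, forall p, prime p && (y < p <= y.*2.+1)%N} -> (1 < y)%N ->
  let S : {poly int} := \sum_(p <- s) 'X^p in
  let F := 'Phi_(2 * \prod_(p <- s) p)%N in
  exists h, if odd (size s) then F * (1 + 'X) = 1 + S + h * 'X^(y.+1 * 2)
            else F = (1 + 'X) * (1 - S) + h * 'X^(y.+1 * 2).
Proof.
move=> + + y_gt1.
(* Hides x^(y+1) behind an equation, making it an atom for [ring]. *)
have [T DT] : exists T : {poly int}, T = 'X^(y.+1) by exists 'X^(y.+1).
have DXp p : (y < p)%N -> 'X^p = T * 'X^(p - y.+1).
  by move=> lt_y; rewrite DT -exprD subnKC.
elim: s => [_ _|p s IHs] /=.
  by exists 0; rewrite !big_nil muln1 Cyclotomic_2; ring.
case/andP => s'p s_uniq s_pr.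
have s_pr' q (s_q : q \in s) := s_pr q (mem_behead (s := p :: s) s_q).
have {}IHs := IHs s_uniq s_pr'.
have /andP[p_pr /andP[lt_yp le_p]] := s_pr p (mem_head _ _).
have [G DG] : exists G, \sum_(q <- s) 'X^q = T * G.
  exists (\sum_(q <- s) 'X^(q - y.+1)); rewrite mulr_sumr.
  by apply: eq_big_seq => q /s_pr'/and3P[_ lt_yq _]; apply: DXp.
have count_s_lt2 i : (i < 2)%N -> count_mem i s = 0%N.
  by move=> lt_i; apply/count_memPn/negP => /s_pr'; lia.
have p'N : ~~ (p %| 2 * \prod_(q <- s) q)%N.
  rewrite Euclid_dvdM // negb_or dvdn_prime2 // gtn_eqF; last by lia.
  rewrite -prime_coprime // coprime_sym big_seq.
  apply: (big_ind (coprime^~ p)) => [|a b|q s_q]; first exact: coprime1n.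
    by rewrite coprimeMl => -> ->.
  have /andP[q_pr _] := s_pr' q s_q.
  rewrite coprime_sym prime_coprime // dvdn_prime2 //.
  by apply: contraNneq s'p => ->.
have := Cyclotomic_mul_prime p_pr p'N.
(* As p >= y + 1, the term in x^(2p) is already 0 modulo x^(2y+2), so only the coefficients of Phi_N
   in degrees 0 and 1 matter. *)
have [h ->] := comp_polyXn_modXn 'Phi_(2 * \prod_(q <- s) q)%N
  (prime_gt0 p_pr) (leq_mul lt_yp (leqnn 2)).
rewrite !big_cons (mulnC p) mulnA.
move: (2 * _)%N IHs {p'N} => N; rewrite exprM -DT DG DXp // => -[h1 E].
have lt1 : (1 < y.+1 * 2)%N by lia.
have coef_low (q q1 h0 : {poly int}) i :
    q = q1 + h0 * T ^+ 2 -> (i < 2)%N -> q`_i = q1`_i.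
  by move=> -> lt_i; rewrite DT -exprM coef_add_mulXn //; lia.
have S0 : (T * G)`_0 = 0 by rewrite -DG coef_sumXn count_s_lt2.
have S1 : (T * G)`_1 = 0 by rewrite -DG coef_sumXn count_s_lt2.
(* The induction hypothesis gives Phi_N constant coefficient 1, and linear coefficient -1 or 1 as
   the number of primes is odd or even. This sign decides which step lemma applies. *)
case: ifP E => [odd_s|even_s] E /=.
  have := coef_low _ _ _ 0%N E isT.
  rewrite mulrDr mulr1 !coefD coefMX coef1 S0 /= !addr0 => N0.
  have := coef_low _ _ _ 1%N E isT.
  rewrite mulrDr mulr1 !coefD coefMX coef1 S1 /= N0 addr0.
  move/eqP; rewrite addr_eq0 => /eqP -> E'.
  have {}E' : 'Phi_(N * p)%N * 'Phi_N = 1 - T * 'X^(p - y.+1) + h * T ^+ 2.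
    by rewrite E' ?polyCN polyC1; ring.
  have [h' ->] := Suzuki_step_odd E E'.
  by exists h'; ring.
have := coef_low _ _ _ 0%N E isT.
rewrite mulrDl mul1r coefD coefXM coefB coef1 S0 /= addr0 subr0 => N0.
have := coef_low _ _ _ 1%N E isT.
rewrite mulrDl mul1r coefD coefXM !coefB !coef1 S0 S1 /= subr0 add0r => N1.
rewrite N0 N1 => E'.
have {}E' : 'Phi_(N * p)%N * 'Phi_N = 1 + T * 'X^(p - y.+1) + h * T ^+ 2.
  by rewrite E' ?polyCN polyC1; ring.
have [h' ->] := Suzuki_step_even E E'.
by exists h'; ring.
Qed.

(** Multiplying by 1 + x turns the congruence into a recurrence for the sum of two consecutive
    coefficients, solved by induction on k. *)
Lemma coef_Cyclotomic_double_prod [y s k] : odd (size s) ->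
  uniq s -> {in s, forall p, prime p && (y < p <= y.*2.+1)%N} -> (1 < y)%N ->
  (k < y.+1 * 2)%N ->
  ('Phi_(2 * \prod_(p <- s) p)%N)`_k =
  (-1) ^+ k * (1 - (count (leq^~ k) s)%:R).
Proof.
move=> odd_s s_uniq s_pr y_gt1 lt_k.
have [h] := Cyclotomic_double_prod_modXn s_uniq s_pr y_gt1; rewrite odd_s.
move: 'Phi_ _ => F E.
have {E} rec i : (i < y.+1 * 2)%N ->
    F`_i + (if i is j.+1 then F`_j else 0) =
    (i == 0%N)%:R + (count_mem i s)%:R.
  move/(coef_add_mulXn (1 + \sum_(p <- s) 'X^p) h).
  rewrite -E mulrDr mulr1 !coefD coefMX coef1 coef_sumXn.
  by case: i.
elim: k lt_k => [|k IHk] lt_k.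
  have := rec 0%N lt_k; rewrite addr0 => ->; rewrite expr0 mul1r /=.
  have -> : count_mem 0%N s = 0%N by apply/count_memPn/negP => /s_pr.
  have -> : count (leq^~ 0%N) s = 0%N; last by [].
  by apply/eqP; rewrite -leqn0 leqNgt -has_count; apply/hasPn => p /s_pr; lia.
move: (rec k.+1 lt_k) => /(canRL (addrK _)) ->; rewrite (IHk (ltnW lt_k)) add0r.
have -> : count (leq^~ k.+1) s = (count (leq^~ k) s + count_mem k.+1 s)%N.
  rewrite -count_predUI (eq_count (a1 := predI _ _) (a2 := pred0)); last first.
    by move=> i /=; lia.
  by rewrite count_pred0 addn0; apply: eq_count => i /=; lia.
(* When k + 1 belongs to s it is an odd prime, so k is even and the sign disappears. *)
suff : (-1) ^+ k * (count_mem k.+1 s)%:R = (count_mem k.+1 s)%:R :> int.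
  by rewrite natrD exprS => {1}<-; ring.
have [s_k|/count_memPn->] := boolP (k.+1 \in s); last by rewrite mulr0.
have /and3P[k_pr lt_yk _] := s_pr _ s_k; have [k1|] := even_prime k_pr; first lia.
by rewrite /= -signr_odd => /negPf->; rewrite mul1r.
Qed.

(** * Adjoining irreducible factors without changing low coefficients *)

(** Modulo x^(q^k), the identity Phi_(q^(k+1)) (x^(q^k) - 1) = x^(q^(k+1)) - 1 reads -Phi_(q^(k+1))
    = -1. *)
Lemma Cyclotomic_prime_power_modXn [q k K] : prime q -> (K <= q ^ k)%N ->
  exists h, 'Phi_(q ^ k.+1)%N = 1 + h * 'X^K.
Proof.
move=> q_pr le_K; set F := 'Phi_ _.
have le_K' : (K <= q ^ k.+1)%N.
  by rewrite (leq_trans le_K) // leq_pexp2l ?prime_gt0.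
exists (F * 'X^(q ^ k - K)%N - 'X^(q ^ k.+1 - K)%N).
rewrite mulrBl -mulrA -!exprD !subnK //.
have := Cyclotomic_prime_power_mul q k q_pr; rewrite -/F => E.
transitivity (F * 'X^(q ^ k)%N - F * ('X^(q ^ k)%N - 1)); first by ring.
by rewrite E; ring.
Qed.

Lemma divisor_Xn_sub1_same_low_coefs N K m : (0 < N)%N ->
  exists (l : nat) (f : {poly int}),
    [/\ (0 < l)%N, ring_dvd f ('X^l - 1), has_exactly_irreducible_factors m.+1 f &
        forall k, (k < K)%N -> f`_k = ('Phi_N)`_k].
Proof.
move=> N_gt0; have [q lt_q q_pr] := prime_above (maxn N K).
move: lt_q; rewrite gtn_max => /andP[lt_Nq lt_Kq].
have q_gt1 := prime_gt1 q_pr; have q_gt0 := ltnW q_gt1.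
(* The exponents of q start at 2: Phi_q = 1 + x + ... would alter low coefficients, whereas
   Phi_(q^2) is 1 modulo x^q. Since q > N, no index repeats. *)
pose d (i : 'I_m.+1) := if i == ord0 then N else (q ^ i.+1)%N.
have ne_N i : N != (q ^ i.+1)%N.
  by rewrite neq_ltn (leq_trans lt_Nq) // -{1}[q]expn1 leq_pexp2l.
have d_inj : injective d.
  move=> i j; rewrite /d.
  case: eqVneq => [->|i_neq]; case: eqVneq => [->|j_neq] //.
  - by move/eqP; rewrite (negPf (ne_N _)).
  - by move/esym/eqP; rewrite (negPf (ne_N _)).
  by move/eqP; rewrite eqn_exp2l // eqSS => /eqP/val_inj.
have d_gt0 i : (0 < d i)%N.
  by rewrite /d; case: ifP => // _; rewrite expn_gt0 q_gt0.
have l_gt0 : (0 < N * q ^ m.+1)%N.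
  by rewrite muln_gt0 N_gt0 expn_gt0 q_gt0.
exists (N * q ^ m.+1)%N, (\prod_i 'Phi_(d i)); split=> //.
- rewrite -prod_Cyclotomic //.
  apply: (ring_dvd_prod_seq Cyclotomic) => [|//|i]; first exact: divisors_uniq.
  rewrite -dvdn_divisors // /d; case: ifP => _; first exact: dvdn_mulr.
  by rewrite dvdn_mull // dvdn_exp2l.
- exact: has_exactly_irreducible_factors_Cyclotomic.
move=> k lt_k; rewrite big_ord_recl /=.
have [h ->] : exists h, \prod_(i < m) 'Phi_(d (lift ord0 i)) = 1 + h * 'X^K.
  apply: (big_ind (fun p => exists h, p = 1 + h * 'X^K))
    => [|_ _ [h1 ->] [h2 ->]|i _].
  - by exists 0; rewrite mul0r addr0.
  - by exists (h1 + h2 + h1 * h2 * 'X^K); ring.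
  apply: Cyclotomic_prime_power_modXn => //=.
  by rewrite (leq_trans (ltnW lt_Kq)) // -{1}[q]expn1 leq_pexp2l.
by rewrite mulrDr mulr1 mulrA coef_add_mulXn.
Qed.

(** * Choice of the primes and the values attained *)

Theorem proposition2p1 (n m : nat) (hn : (0 < n)%N) (hm : (0 < m)%N) :
  exists (l : nat) (f : {poly int}),
    [/\ (0 < l)%N,
        ring_dvd f ('X^l - 1),
        has_exactly_irreducible_factors m f &
        forall k : int, - n%:Z <= k <= n%:Z ->
          exists i : nat, (1 <= i <= (size f).-1)%N /\ f`_i = k].
Proof.
(* This t is odd, as the coefficient formula requires, and exceeds n + 1, so that [s] has an entry
   at position n + 1. *)
pose t := n.*2.+3; have [y y_gt1 le_t] := many_primes_in_dyadic_interval t.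
pose s := take t (filter prime (index_iota y.+1 y.*2.+1)).
have size_s : size s = t by rewrite size_takel // size_filter.
have s_sorted : sorted ltn s.
  rewrite take_sorted // sorted_filter //; first exact: ltn_trans.
  exact: iota_ltn_sorted.
have s_pr : {in s, forall p, prime p && (y < p <= y.*2.+1)%N}.
  by move=> p /mem_take; rewrite mem_filter mem_index_iota => /andP[-> /=]; lia.
have s_le p : p \in s -> (p <= y.*2)%N.
  by move=> /mem_take; rewrite mem_filter mem_index_iota => /and3P[].
have s_odd p : p \in s -> odd p.
  by case/s_pr/and3P => /even_prime[]; first lia.
have s_uniq : uniq s by exact: sorted_uniq ltn_trans ltnn s s_sorted.
have odd_s : odd (size s) by rewrite size_s /t /= odd_double.
have nth_s j : (j < t)%N -> nth 0%N s j \in s.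
  by move=> lt_j; rewrite mem_nth ?size_s.
have count_nth j : (j < t)%N -> count (leq^~ (nth 0%N s j)) s = j.+1.
  by move=> lt_j; rewrite -[RHS](count_le_nth 0%N (s := s)) ?size_s.
(* The successor of an odd prime is even, hence not in [s], so the count stays the same while the
   sign of the coefficient flips. *)
have count_nth1 j : (j < t)%N -> count (leq^~ (nth 0%N s j).+1) s = j.+1.
  move=> lt_j; rewrite -(count_nth j lt_j); apply: eq_in_count => p s_p /=.
  rewrite leq_eqVlt ltnS; case: eqVneq => // Dp.
  by have := s_odd _ s_p; rewrite Dp /= s_odd // nth_s.
have N_gt0 : (0 < 2 * \prod_(p <- s) p)%N.
  by rewrite muln_gt0 big_seq prodn_cond_gt0 // => p /s_pr/andP[/prime_gt0].
case: m hm => // m _.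
have [l [f [l_gt0 f_dvd f_irr f_coef]]] :=
  divisor_Xn_sub1_same_low_coefs _ (y.+1 * 2) m N_gt0.
exists l, f; split=> //.
have {f_coef} f_coef i : (i < y.+1 * 2)%N ->
    f`_i = (-1) ^+ i * (1 - (count (leq^~ i) s)%:R).
  move=> lt_i; rewrite f_coef //.
  by rewrite (coef_Cyclotomic_double_prod odd_s s_uniq s_pr).
(* Positions in [s] start at 0: the count is j + 1, and the coefficient is -(1 - (j + 1)) = j. *)
have f_nth j : (j < t)%N -> f`_(nth 0%N s j) = j%:Z.
  move=> lt_j; have s_p := nth_s j lt_j; have bnd := s_pr _ s_p.
  rewrite f_coef ?count_nth; last lia.
    by rewrite -signr_odd s_odd // expr1 -natr1 natz; ring.
  by [].
have f_nth1 j : (j < t)%N -> f`_(nth 0%N s j).+1 = - j%:Z.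
  move=> lt_jt; have s_p := nth_s j lt_jt; have bnd := s_le _ s_p.
  rewrite f_coef ?count_nth1; [|by []|lia].
  by rewrite -signr_odd /= s_odd // expr0 -natr1 natz; ring.
(* The coefficient at position n + 1 of [s] is n + 1, hence nonzero. This bounds the degree from
   below, and so covers every index used, even where the coefficient is 0. *)
have size_f : (nth 0%N s n.+1 < size f)%N.
  rewrite ltnNge; apply/negP => /(nth_default 0); rewrite f_nth //.
  by rewrite /t; lia.
have lt_nth i j : (i < j < t)%N -> (nth 0 s i < nth 0 s j)%N.
  move=> /andP[lt_ij lt_j]; apply: (sorted_ltn_nth ltn_trans) => //.
    by rewrite inE size_s (ltn_trans lt_ij).
  by rewrite inE size_s.
move=> k le_k; pose j := `|k|%N; have le_j : (j <= n)%N by rewrite /j; lia.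
have lt_jt : (j < t)%N by rewrite /t; lia.
have lt_j1 : (nth 0 s j < nth 0 s n.+1)%N by apply: lt_nth; rewrite /t; lia.
have p_gt0 := s_pr _ (nth_s j lt_jt).
have [k_ge0 | k_lt0] := leP 0 k.
  by exists (nth 0%N s j); rewrite f_nth //; split; lia.
by exists (nth 0%N s j).+1; rewrite f_nth1 //; split; lia.
Qed.
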